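(* Let $G$ be a group and let $\lambda : G \to \operatorname{Aut} G$, $a \mapsto \lambda_a$, be a group homomorphism. If $G \neq 1$ and $\operatorname{Ker} \lambda = 1$, then the subset $H_{\lambda} = \{ (\lambda_a, a) \mid a \in G \}$ of $\operatorname{Hol} G$ is not a group (i.e. not a subgroup of $\operatorname{Hol} G$).
   Context: The holomorph $\operatorname{Hol} G = \operatorname{Aut} G \ltimes G$ is the set of pairs $(f,a)$ with $f \in \operatorname{Aut} G$, $a \in G$, with product $(f,a)(g,b) = (fg, a f(b))$. *)

(* Defs.v *)
From HB Require Import structures.
From mathcomp Require Import all_boot.
From mathcomp Require Import boolp classical_sets.
Set Implicit Arguments.
Unset Strict Implicit.
Unset Printing Implicit Defensive.
Local Open Scope group_scope.
Local Open Scope classical_set_scope.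

Section Aut.
Variable G : groupType.

Record Aut := MkAut {
  aut_fun :> G -> G;
  aut_mul : {morph aut_fun : x y / x * y};
  aut_bij : bijective aut_fun }.

HB.instance Definition _ := gen_eqMixin Aut.
HB.instance Definition _ := gen_choiceMixin Aut.
HB.instance Definition _ (f : Aut) :=
  isMultiplicative.Build G G (aut_fun f) (@aut_mul f).

Lemma aut_ext (f g : Aut) : f =1 g -> f = g.
Proof.
case: f g => [f fM fB] [g gM gB] /= /funext fg.
move: fM fB; rewrite fg => fM fB.
by congr MkAut; exact: Prop_irrelevance.
Qed.

Definition aut_one : Aut := @MkAut idfun (fun _ _ => erefl) (Bijective (fun=> erefl) (fun=> erefl)).

Lemma aut_comp_mul (f g : Aut) : {morph f \o g : x y / x * y}.
Proof. by move=> x y /=; rewrite !aut_mul. Qed.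

Definition aut_comp (f g : Aut) : Aut :=
  MkAut (aut_comp_mul f g) (bij_comp (aut_bij f) (aut_bij g)).

Lemma aut_inv_exists (f : Aut) : exists g : G -> G, cancel f g /\ cancel g f.
Proof. by case: (aut_bij f) => g fK gK; exists g. Qed.

Definition aut_inv_fun (f : Aut) : G -> G := projT1 (cid (aut_inv_exists f)).

Lemma aut_funK (f : Aut) : cancel f (aut_inv_fun f).
Proof. by rewrite /aut_inv_fun; case: cid => g []. Qed.

Lemma aut_inv_funK (f : Aut) : cancel (aut_inv_fun f) f.
Proof. by rewrite /aut_inv_fun; case: cid => g []. Qed.

Lemma aut_inv_mul (f : Aut) : {morph aut_inv_fun f : x y / x * y}.
Proof.
by move=> x y; apply: (can_inj (aut_funK f)); rewrite aut_mul !aut_inv_funK.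
Qed.

Definition aut_inv (f : Aut) : Aut :=
  MkAut (@aut_inv_mul f) (Bijective (aut_inv_funK f) (aut_funK f)).

Lemma aut_compA : associative aut_comp.
Proof. by move=> f g h; apply: aut_ext. Qed.

Lemma aut_comp1f : left_id aut_one aut_comp.
Proof. by move=> f; apply: aut_ext. Qed.

Lemma aut_compf1 : right_id aut_one aut_comp.
Proof. by move=> f; apply: aut_ext. Qed.

Lemma aut_compVf : left_inverse aut_one aut_inv aut_comp.
Proof. by move=> f; apply: aut_ext => x /=; rewrite aut_funK. Qed.

Lemma aut_compfV : right_inverse aut_one aut_inv aut_comp.
Proof. by move=> f; apply: aut_ext => x /=; rewrite aut_inv_funK. Qed.

HB.instance Definition _ := isGroup.Build Aut
  aut_compA aut_comp1f aut_compf1 aut_compVf aut_compfV.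

End Aut.

Section Hol.
Variable G : groupType.

(* A record rather than the product type [Aut G * G], on which the library
   already puts the direct product group structure. *)
Record Hol := MkHol { hol_aut : Aut G; hol_elt : G }.

HB.instance Definition _ := gen_eqMixin Hol.
HB.instance Definition _ := gen_choiceMixin Hol.

Definition hol_one : Hol := MkHol 1 1.

Definition hol_mul (x y : Hol) : Hol :=
  MkHol (hol_aut x * hol_aut y) (hol_elt x * hol_aut x (hol_elt y)).

Definition hol_inv (x : Hol) : Hol :=
  MkHol (hol_aut x)^-1 ((hol_aut x)^-1 (hol_elt x)^-1).

Lemma aut_mul_one (f : Aut G) : f 1 = 1.
Proof. by apply: (mulgI (f 1)); rewrite -aut_mul !mulg1. Qed.

Lemma hol_mulA : associative hol_mul.
Proof.
by case=> [f a] [g b] [h c]; rewrite /hol_mul /= !mulgA aut_mul !mulgA.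
Qed.

Lemma hol_mul1x : left_id hol_one hol_mul.
Proof. by case=> f a; rewrite /hol_mul /= !mul1g. Qed.

Lemma hol_mulx1 : right_id hol_one hol_mul.
Proof. by case=> f a; rewrite /hol_mul /= aut_mul_one !mulg1. Qed.

Lemma hol_mulVx : left_inverse hol_one hol_inv hol_mul.
Proof.
case=> f a.
have e : (f^-1 a^-1) * (f^-1 a) = 1 by rewrite -aut_mul mulVg aut_mul_one.
by rewrite /hol_mul /hol_inv [X in MkHol _ X]e mulVg.
Qed.

Lemma hol_mulxV : right_inverse hol_one hol_inv hol_mul.
Proof.
case=> f a.
have e : a * f (f^-1 a^-1) = 1 by rewrite [f _]aut_inv_funK mulgV.
by rewrite /hol_mul /hol_inv [X in MkHol _ X]e mulgV.
Qed.

HB.instance Definition _ := isGroup.Build Hol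
  hol_mulA hol_mul1x hol_mulx1 hol_mulVx hol_mulxV.

End Hol.

Definition gker (G H : groupType) (f : G -> H) : set G := f @^-1` [set 1].

Definition Hlam (G : groupType) (lam : G -> Aut G) : set (Hol G) :=
  [set MkHol (lam a) a | a in [set: G]].

Definition is_subgroup (G : groupType) (S : set G) : Prop :=
  group_closed [in S].

(* Main.v *)
(* If [Hlam lam] is closed under products, then
   (lam a, a) (lam b, b) = (lam (a b), a lam_a(b)) must be (lam c, c), so that
   lam (a b) = lam (a lam_a(b)); injectivity of lam gives lam_a(b) = b for all
   a and b, hence lam is trivial and its kernel is all of G. *)
Require Import Defs.
From HB Require Import structures.
From mathcomp Require Import all_boot.
From mathcomp Require Import boolp classical_sets.
Local Open Scope group_scope.
Local Open Scope classical_set_scope.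

Lemma gker1_inj (G H : groupType) (f : {multiplicative G -> H}) :
  gker f = [set 1] -> injective f.
Proof.
move=> ker1 x y fxy; apply: divg1_eq.
suff : gker f (x / y) by rewrite ker1.
(* Membership unfolds to [f (x / y) = 1]; multiplying by [f y] on the right turns it into
   [f x = f y]. *)
by apply: (mulIg (f y)); rewrite -gmulfM mulgVK mul1g.
Qed.

Theorem corollary2p9 (G : groupType) (lam : {multiplicative G -> Aut G})
    (G_neq1 : [set: G] <> [set 1]) (ker1 : gker lam = [set 1]) :
  ~ is_subgroup (Hlam lam).
Proof.
(* By [ker1], it suffices that the kernel is all of [G]. *)
move=> /group_closedM HM; apply: G_neq1; rewrite -ker1.
have fix_lam a b : lam a b = b.
  have Hin c : MkHol (lam c) c \in Hlam lam by apply/mem_set; exists c.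
  (* Comparing components gives [lam c = lam a * lam b] and [c = a * lam a b]. *)
  have /set_mem[c _ [lamc cE]] := HM _ _ (Hin a) (Hin b).
  have {lamc} : lam c = lam (a * b) by rewrite gmulfM.
  by move/(gker1_inj _ _ _ ker1); rewrite cE => /mulgI.
apply/seteqP; split=> // a _.
(* Kernel membership unfolds to [lam a = 1], which is checked pointwise. *)
by apply: aut_ext => b; rewrite fix_lam.
Qed.
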